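(* Let $X$ be a real Banach space with $\dim X\ge 2$ and let $H$ be a real Hilbert space with $\dim H\ge 2$. Then for every $\varepsilon\in[0,2]$ $$\varphi_X^-(\varepsilon)\le \varphi_H^-(\varepsilon)=\frac{\varepsilon^2}{2}=\varphi_H^+(\varepsilon)\le \varphi_X^+(\varepsilon).$$
   Context: For a real Banach space $X$ with dual $X^*$, $\partial B$ denotes the unit sphere of $X$, $\partial B^*$ the unit sphere of $X^*$, and $\langle p,x\rangle$ the value of $p\in X^*$ at $x\in X$. For $x\in\partial B$ put $J_1(x)=\{p\in\partial B^*: \langle p,x\rangle=\|x\|\}$. For $\varepsilon\in[0,2]$ define $$\varphi_X^-(\varepsilon)=\inf\{\langle p,x-z\rangle: x,z\in\partial B,\ \|x-z\|\ge\varepsilon,\ p\in J_1(x)\},$$ $$\varphi_X^+(\varepsilon)=\sup\{\langle p,x-z\rangle: x,z\in\partial B,\ \|x-z\|\le\varepsilon,\ p\in J_1(x)\}.$$ *)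

(* Defs.v *)
From HB Require Import structures.
From mathcomp Require Import all_boot all_order all_algebra.
From mathcomp Require Import all_classical all_reals all_analysis.
Set Implicit Arguments.
Unset Strict Implicit.
Unset Printing Implicit Defensive.
Import Order.TTheory GRing.Theory Num.Theory.
Import numFieldNormedType.Exports.
Local Open Scope classical_set_scope.
Local Open Scope ring_scope.

(* Covers infinite-dimensional modules: some n vectors are linearly
   independent. *)
Definition dim_ge (R : realType) (n : nat) (V : lmodType R) : Prop :=
  exists v : 'I_n -> V, forall a : 'I_n -> R,
    \sum_(i < n) a i *: v i = 0 -> forall i, a i = 0.

Definition unit_sphere (R : realType) (X : normedModType R) : set X :=
  [set x | `|x| = 1].

(* [sup] is the real-valued supremum, so this is the dual norm only for
   continuous [p] (otherwise the set is unbounded and [sup] is a default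
   value); [dual_unit_sphere] therefore requires continuity explicitly. *)
Definition dual_norm (R : realType) (X : normedModType R)
    (p : {linear X -> R^o}) : R :=
  sup [set `|p x| | x in [set x : X | `|x| <= 1]].

Definition dual_unit_sphere (R : realType) (X : normedModType R) :
    set {linear X -> R^o} :=
  [set p : {linear X -> R^o} | continuous p /\ dual_norm p = 1].

Definition J1 (R : realType) (X : normedModType R) (x : X) :
    set {linear X -> R^o} :=
  [set p : {linear X -> R^o} | dual_unit_sphere p /\ p x = `|x|].

(* The infimum and supremum are taken in the extended reals, where they exist
   without any nonemptiness or boundedness condition. *)
Definition phi_minus (R : realType) (X : normedModType R) (eps : R) : \bar R :=
  ereal_inf [set t | exists (x z : X) (p : {linear X -> R^o}),
    [/\ unit_sphere x, unit_sphere z, eps <= `|x - z|, J1 x p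
      & t = (p (x - z))%:E]].

Definition phi_plus (R : realType) (X : normedModType R) (eps : R) : \bar R :=
  ereal_sup [set t | exists (x z : X) (p : {linear X -> R^o}),
    [/\ unit_sphere x, unit_sphere z, `|x - z| <= eps, J1 x p
      & t = (p (x - z))%:E]].

(* Main.v *)
Require Import Defs.
From HB Require Import structures.
From mathcomp Require Import all_boot all_order all_algebra.
From mathcomp Require Import all_classical all_reals all_analysis.
From mathcomp Require Import ring lra.
Import Order.TTheory GRing.Theory Num.Theory.
Import numFieldNormedType.Exports.
Local Open Scope classical_set_scope.
Local Open Scope ring_scope.

(** The equalities for [H] are a computation.  A norm-one functional [p] with
    [p x = |x| = 1] is the inner product with [x] ([J1_dot]), so
    [p (x - z) = 1 - <x, z> = |x - z|^2 / 2], which is bounded by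
    [eps^2 / 2] from below when [|x - z| >= eps] and from above when
    [|x - z| <= eps].  Everything else follows from one statement about an
    arbitrary normed space of dimension at least two ([sphere_chord], which is
    also applied to [H]): there are unit vectors with [|x - z| = eps] and a
    [p] in [J1 x] with [p (x - z) <= eps^2 / 2], and there are such [x], [z],
    [p], in general different ones, with [p (x - z) >= eps^2 / 2].

    Such a statement only concerns a plane, because a functional on a plane
    extends without increasing its norm ([hahn_banach_cone]).  In the plane let
    [x], [z] move once around the unit circle with [x - z = eps w], [w] a unit
    vector too.  With [dx] tangent at [x], a support functional at [x] is
    [p v = (v /\ dx) / (x /\ dx)], hence
    [[
      eps^2 (w /\ dw) = (x - z) /\ (dx - dz)
                      = p (x - z) (x /\ dx) + q (z - x) (z /\ dz)
    ]]
    where [q] supports the unit disc at [z].  The three area forms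
    [x /\ dx], [z /\ dz], [w /\ dw] have the same integral over a full turn, so
    the mean of [p (x - z)] and [q (z - x)] is [eps^2 / 2].

    The integral is replaced by an extremum, which needs no parametrisation of
    the pairs [(x, z)] and no smoothness of the norm.  If [S t] is twice the
    area of the sector of the unit disc up to the polar angle [t]
    ([antiderivative_on]), the common integral over a turn says that
    [S s + S t - 2 S u], where [s], [t], [u] are the angles of [x], [z], [w], is
    periodic; therefore it attains a maximum and a minimum on the compact set of
    all triples ([chord_triple_compact]).  At a maximum, moving
    counterclockwise forces [x /\ dx + z /\ dz <= 2 (w /\ dw)], and comparing
    with the displayed formula gives [p (x - z) >= eps^2 / 2] or
    [q (z - x) >= eps^2 / 2]; at a minimum the inequalities are reversed
    ([potential_increase], [plane_chord]).  Here [dx] is a one-sided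
    derivative: it exists because the norm is convex, and [p] is the support
    functional that vanishes on it ([support_secant]). *)

(** * Extension of dominated functionals *)

Definition sublinear {R : realType} {X : lmodType R} (q : X -> R) : Prop :=
  (forall x y, q (x + y) <= q x + q y) /\
  (forall (k : R) x, 0 < k -> q (k *: x) = k * q x).

Lemma sublinear0 {R : realType} {X : lmodType R} {q : X -> R} :
  sublinear q -> q 0 = 0.
Proof.
by case=> _ qZ; have := qZ 2 0; rewrite scaler0 ltr0n => /(_ isT); lra.
Qed.

Lemma sublinear_geN {R : realType} {X : lmodType R} {q : X -> R} :
  sublinear q -> forall x, - q (- x) <= q x.
Proof.
move=> sq x; have [qD _] := sq; have := qD x (- x).
by rewrite subrr (sublinear0 sq); lra.
Qed.

Lemma sublinear_inf {R : realType} {X : lmodType R} (G : X -> set R) :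
  (forall x, G x !=set0) -> (forall x, has_lbound (G x)) ->
  (forall x y a b, G x a -> G y b -> exists2 c, G (x + y) c & c <= a + b) ->
  (forall (k : R) x a, 0 < k -> G x a ->
    exists2 c, G (k *: x) c & c <= k * a) ->
  sublinear (fun x => inf (G x)).
Proof.
move=> G0 Gb GD GZ.
have Zle k x : 0 < k -> inf (G (k *: x)) <= k * inf (G x).
  move=> k0; rewrite -ler_pdivrMl//; apply: lb_le_inf => // a Ga.
  rewrite ler_pdivrMl//; have [c Gc ca] := GZ k x a k0 Ga.
  exact: le_trans (ge_inf (Gb _) Gc) ca.
split=> [x y|k x k0].
  rewrite /= -lerBlDr; apply: lb_le_inf => // a Ga.
  rewrite lerBlDr -lerBlDl; apply: lb_le_inf => // b Hb.
  rewrite lerBlDl; have [c Gc cab] := GD x y a b Ga Hb.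
  by exact: le_trans (ge_inf (Gb _) Gc) cab.
apply/eqP; rewrite /= eq_le Zle//=.
have := Zle k^-1 (k *: x); rewrite invr_gt0 => /(_ k0).
by rewrite scalerA mulVf ?gt_eqF// scale1r ler_pdivlMl.
Qed.

(** Lowering a sublinear [q] along a convex cone [C] of constraints: this single
    construction serves twice, to make a minimal sublinear functional linear
    (with the half-line through one vector) and to impose the values prescribed
    for the extension.  The infimum of [q (x + m) - c] over [(m, c)] in [C] is
    finite because [q (x + m) - c >= q m - q (- x) - c >= - q (- x)]. *)
Lemma sublinear_relax {R : realType} {X : lmodType R} {q : X -> R}
    {C : set (X * R)} :
  sublinear q -> C (0, 0) ->
  (forall m n, C m -> C n -> C (m.1 + n.1, m.2 + n.2)) ->
  (forall (k : R) m, 0 < k -> C m -> C (k *: m.1, k * m.2)) ->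
  (forall m, C m -> m.2 <= q m.1) ->
  exists q' : X -> R, [/\ sublinear q', forall x, q' x <= q x &
    forall x m, C m -> q' x <= q (x + m.1) - m.2].
Proof.
move=> sq C0 CD CZ Cq; have [qD qZ] := sq.
pose G (x : X) := [set q (x + m.1) - m.2 | m in C].
have Gb x : has_lbound (G x).
  exists (- q (- x)) => _ [m Cm <-]; have := Cq m Cm.
  by have := qD (x + m.1) (- x); rewrite addrAC subrr add0r; lra.
exists (fun x => inf (G x)); split.
- apply: sublinear_inf => //.
  + by move=> x; exists (q (x + 0) - 0); exists (0, 0).
  + move=> x y _ _ [m Cm <-] [n Cn <-].
    exists (q (x + y + (m.1 + n.1)) - (m.2 + n.2)).
      by exists (m.1 + n.1, m.2 + n.2) => //; exact: CD.
    by have := qD (x + m.1) (y + n.1); rewrite addrACA; lra.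
  + move=> k x _ k0 [m Cm <-].
    exists (q (k *: x + k *: m.1) - k * m.2).
      by exists (k *: m.1, k * m.2) => //; exact: CZ.
    by rewrite -scalerDr qZ// mulrBr.
- by move=> x; apply: ge_inf => //; exists (0, 0); rewrite //= addr0 subr0.
- by move=> x m Cm; apply: ge_inf => //; exists m.
Qed.

(** Zorn: the infimum of a chain of sublinear functionals below [P] is
    sublinear, and finite since each of them is at least [- P (- x)] at [x]. *)
Lemma sublinear_minimal {R : realType} {X : lmodType R} {P : X -> R} :
  sublinear P -> exists q : X -> R, [/\ sublinear q, forall x, q x <= P x &
    forall q', sublinear q' -> (forall x, q' x <= q x) -> q' = q].
Proof.
move=> sP; pose T := {q : X -> R | sublinear q /\ forall x, q x <= P x}.
pose le (q q' : T) := `[< forall x, sval q' x <= sval q x >].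
have T0 : sublinear P /\ (forall x, P x <= P x) by [].
have [| | | |[q [sq qP]] qmin] := @Zorn T le.
- by move=> q; apply/asboolP.
- move=> q r s /asboolP qr /asboolP rs; apply/asboolP => x.
  exact: le_trans (rs x) (qr x).
- move=> [q hq] [r hr] /asboolP /= qr /asboolP /= rq; apply: eq_exist.
  by apply/funext => x; apply/eqP; rewrite eq_le qr rq.
- move=> A totA; have [[q0 Aq0]|A0] := pselect (A !=set0); last first.
    by exists (exist _ P T0) => s As; exfalso; apply: A0; exists s.
  pose G (x : X) := [set sval q x | q in A].
  have Gb x : has_lbound (G x).
    exists (- P (- x)) => _ [q Aq <-]; have [sq qP] := svalP q.
    by have := sublinear_geN sq x; have := qP (- x); lra.
  have sG : sublinear (fun x => inf (G x)).
    apply: sublinear_inf => //.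
    + by move=> x; exists (sval q0 x), q0.
    + move=> x y _ _ [q Aq <-] [r Ar <-] /=.
      have [[qD _] _] := svalP q; have [[rD _] _] := svalP r.
      have [/asboolP qr|/asboolP rq] := totA _ _ Aq Ar.
        exists (sval r (x + y)); first by exists r.
        by have /= := rD x y; have /= := qr x; lra.
      exists (sval q (x + y)); first by exists q.
      by have /= := qD x y; have /= := rq y; lra.
    + move=> k x _ k0 [q Aq <-]; have [[_ qZ] _] := svalP q.
      by exists (sval q (k *: x)); [exists q|rewrite qZ].
  have GP x : inf (G x) <= P x.
    by apply: (le_trans (ge_inf (Gb x) _)) ((svalP q0).2 x); exists q0.
  exists (exist _ (fun x => inf (G x)) (conj sG GP)) => s As.
  apply/asboolP => x /=.
  by apply: ge_inf => //; exists s.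
exists q; split => // q' sq' q'q.
have h : sublinear q' /\ forall x, q' x <= P x.
  by split => // x; exact: le_trans (q'q x) (qP x).
by have /(congr1 sval) := qmin (exist _ q' h) (asboolT q'q).
Qed.

(** A minimal sublinear [q] is linear: relaxing it along the half-line of
    multiples of [a] cannot lower it, and this reads [q (- a) <= - q a]. *)
Lemma sublinear_dominates_linear {R : realType} {X : lmodType R} {P : X -> R} :
  sublinear P -> exists p : {linear X -> R^o}, forall x, p x <= P x.
Proof.
move=> sP; have [q [sq qP qmin]] := sublinear_minimal sP.
have [qD qZ] := sq; have q0 := sublinear0 sq.
have qN a : q (- a) = - q a.
  pose C : set (X * R) := [set m | exists2 t, 0 <= t & m = (t *: a, t * q a)].
  have [| | | |q' [sq' q'q q'C]] := @sublinear_relax _ _ _ C sq.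
  - by exists 0; rewrite ?scale0r ?mul0r.
  - move=> _ _ [t t0 ->] [s s0 ->]; exists (t + s); first by rewrite addr_ge0.
    by rewrite /= scalerDl mulrDl.
  - move=> k _ k0 [t t0 ->]; exists (k * t); first by rewrite mulr_ge0// ltW.
    by rewrite /= scalerA mulrA.
  - move=> _ [t t0 ->] /=; move: t0; rewrite le_eqVlt => /predU1P[<-|t0].
      by rewrite scale0r mul0r q0.
    by rewrite qZ.
  have Ca : C (a, q a) by exists 1; rewrite ?scale1r ?mul1r.
  have := q'C (- a) _ Ca; rewrite /= addNr q0 (qmin q') //.
  by have := sublinear_geN sq a; lra.
have qDE x y : q (x + y) = q x + q y.
  apply/eqP; rewrite eq_le qD /=; have := qD (- x) (- y).
  by rewrite -opprD !qN; lra.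
have qZE k x : q (k *: x) = k * q x.
  have [k0|k0|<-] := ltgtP 0 k; first exact: qZ.
    by rewrite -[k]opprK scaleNr qN qZ ?oppr_gt0// !mulNr.
  by rewrite scale0r mul0r.
have lq : linear (q : X -> R^o) by move=> k x y; rewrite qDE qZE.
pose L := GRing.isLinear.Build _ _ _ _ (q : X -> R^o) lq.
pose p : {linear X -> R^o} := HB.pack (q : X -> R^o) L.
by exists p.
Qed.

(** Prescribing lower bounds on a cone contains the extension of a functional
    [f] from a subspace: take for [C] the graph of [f], whose symmetry turns the
    bounds into equalities. *)
Theorem hahn_banach_cone {R : realType} {X : lmodType R} {q : X -> R}
    {C : set (X * R)} :
  sublinear q -> C (0, 0) ->
  (forall m n, C m -> C n -> C (m.1 + n.1, m.2 + n.2)) ->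
  (forall (k : R) m, 0 < k -> C m -> C (k *: m.1, k * m.2)) ->
  (forall m, C m -> m.2 <= q m.1) ->
  exists2 p : {linear X -> R^o}, forall x, p x <= q x &
    forall m, C m -> m.2 <= p m.1.
Proof.
move=> sq C0 CD CZ Cq.
have [q' [sq' q'q q'C]] := sublinear_relax sq C0 CD CZ Cq.
have [p pq'] := sublinear_dominates_linear sq'.
exists p => [x|m Cm]; first exact: le_trans (pq' x) (q'q x).
have := le_trans (pq' (- m.1)) (q'C (- m.1) m Cm).
by rewrite addNr (sublinear0 sq) linearN; lra.
Qed.

(** * Unit circle of a normed plane in polar coordinates *)

Definition wedge {R : realType} (v w : R^o * R^o) : R := v.1 * w.2 - v.2 * w.1.

Definition pairing {R : realType} (l v : R^o * R^o) : R :=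
  l.1 * v.1 + l.2 * v.2.

(** The type of the plane already carries the maximum norm, used for its
    topology; [N] is the norm that is studied. *)
Definition plane_norm {R : realType} (N : R^o * R^o -> R) : Prop :=
  [/\ forall (k : R) v, N (k *: v) = `|k| * N v,
      forall v w, N (v + w) <= N v + N w &
      forall v, N v = 0 -> v = 0].

Definition unit_dir {R : realType} (t : R) : R^o * R^o := (cos t, sin t).

Definition radial {R : realType} (N : R^o * R^o -> R) (t : R) : R :=
  (N (unit_dir t))^-1.

Definition circ {R : realType} (N : R^o * R^o -> R) (t : R) : R^o * R^o :=
  radial N t *: unit_dir t.

Section Plane.
Context {R : realType}.
Implicit Types (v w x z : R^o * R^o) (s t u h : R).

Lemma wedge_decomp x y v : wedge x y != 0 ->
  v = (wedge v y / wedge x y) *: x + (wedge x v / wedge x y) *: y.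
Proof.
case: x y v => [x1 x2] [y1 y2] [v1 v2]; rewrite /wedge /= => w0.
by apply/pair_equal_spec; split; rewrite /= /GRing.scale /=; field.
Qed.

Lemma pairingD l v w : pairing l (v + w) = pairing l v + pairing l w.
Proof. by rewrite /pairing /=; ring. Qed.

Lemma pairingZ l k v : pairing l (k *: v) = k * pairing l v.
Proof. by rewrite /pairing /= /GRing.scale /=; ring. Qed.

Lemma wedge_unit_dir s t : wedge (unit_dir s) (unit_dir t) = sin (t - s).
Proof. by rewrite /wedge /= sinB; ring. Qed.

Context {N : R^o * R^o -> R} (hN : plane_norm N).

Lemma plane_norm0 : N 0 = 0.
Proof. by have [NZ _ _] := hN; rewrite -(scale0r 0) NZ normr0 mul0r. Qed.

Lemma plane_normN v : N (- v) = N v.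
Proof. by have [NZ _ _] := hN; rewrite -scaleN1r NZ normrN1 mul1r. Qed.

Lemma plane_normC v w : N (v - w) = N (w - v).
Proof. by rewrite -plane_normN opprB. Qed.

Lemma plane_normZ_ge0 (k : R) v : 0 <= k -> N (k *: v) = k * N v.
Proof. by have [NZ _ _] := hN => k0; rewrite NZ ger0_norm. Qed.

Lemma plane_normZ_gt0 (k : R) v : 0 < k -> N (k *: v) = k * N v.
Proof. by move/ltW; exact: plane_normZ_ge0. Qed.

Lemma plane_norm_ge0 v : 0 <= N v.
Proof.
have [_ ND _] := hN; have := ND v (- v).
by rewrite subrr plane_norm0 plane_normN; lra.
Qed.

Lemma plane_norm_gt0 v : v != 0 -> 0 < N v.
Proof.
have [_ _ N0] := hN; move=> v0; rewrite lt_neqAle plane_norm_ge0 andbT eq_sym.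
by apply: contra_neq v0 => /N0.
Qed.

Lemma plane_normB_le v w : N v - N w <= N (v - w).
Proof. by have [_ ND _] := hN; have := ND (v - w) w; rewrite subrK; lra. Qed.

Lemma plane_norm_continuous : continuous N.
Proof.
have [NZ ND _] := hN.
pose M := N (1, 0) + N (0, 1).
have NM v : N v <= M * `|v|.
  have {1}-> : v = v.1 *: (1, 0) + v.2 *: (0, 1).
    case: v => a b; apply/pair_equal_spec.
    by split; rewrite /= /GRing.scale /=; ring.
  apply: le_trans (ND _ _) _; rewrite !NZ mulrDl; apply: lerD.
    by rewrite mulrC ler_wpM2l ?plane_norm_ge0// le_max lexx.
  by rewrite mulrC ler_wpM2l ?plane_norm_ge0// le_max lexx orbT.
have M0 : 0 < M + 1 by rewrite ltr_wpDl// addr_ge0 ?plane_norm_ge0.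
move=> v; apply/cvgrPdist_le => /= e e0.
have d0 : 0 < e / (M + 1) by rewrite divr_gt0.
near=> w.
have h : N (v - w) <= e.
  have vw : `|v - w| < e / (M + 1).
    by near: w; apply: cvgr_dist_lt => //; exact: cvg_id.
  move/ltW: vw; rewrite ler_pdivlMr// => vw.
  apply: le_trans (NM _) (le_trans _ vw).
  by rewrite mulrC ler_wpM2l// lerDl.
rewrite ler_norml; have := plane_normB_le v w; have := plane_normB_le w v.
by rewrite plane_normC; lra.
Unshelve. all: by end_near. Qed.

Lemma unit_dir_neq0 t : unit_dir t != 0.
Proof.
apply/eqP => -[c0 s0]; have := cos2Dsin2 t; rewrite c0 s0 expr0n /= addr0.
by move/eqP; rewrite eq_sym oner_eq0.
Qed.

Lemma radial_gt0 t : 0 < radial N t.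
Proof. by rewrite invr_gt0 plane_norm_gt0// unit_dir_neq0. Qed.

Lemma circ_norm t : N (circ N t) = 1.
Proof.
rewrite plane_normZ_ge0 ?ltW ?radial_gt0// mulVf// gt_eqF//.
by rewrite plane_norm_gt0// unit_dir_neq0.
Qed.

Lemma unit_dir_continuous : continuous (@unit_dir R).
Proof.
move=> t; apply: (@cvg_pair _ _ _ _ (nbhs (cos t)) (nbhs (sin t))).
- exact: continuous_cos.
- exact: continuous_sin.
Qed.

Lemma radial_continuous : continuous (radial N).
Proof.
move=> t; apply: cvgV; first by rewrite gt_eqF// plane_norm_gt0// unit_dir_neq0.
apply: continuous_comp; first exact: unit_dir_continuous.
exact: plane_norm_continuous.
Qed.

Lemma circ_continuous : continuous (circ N).
Proof.
by move=> t; apply: cvgZ; [exact: radial_continuous|exact: unit_dir_continuous].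
Qed.

Lemma circDpi t : circ N (t + pi) = - circ N t.
Proof.
have E : unit_dir (t + pi) = - unit_dir t.
  by apply/pair_equal_spec; rewrite /= cosDpi sinDpi.
by rewrite /circ /radial E plane_normN scalerN.
Qed.

Lemma wedge_circ s t :
  wedge (circ N s) (circ N t) = radial N s * radial N t * sin (t - s).
Proof. by rewrite -wedge_unit_dir /wedge /circ /= /GRing.scale /=; ring. Qed.

Lemma wedge_circ_ge0 s t : s <= t -> t <= s + pi ->
  0 <= wedge (circ N s) (circ N t).
Proof.
move=> st tpi; have rs := radial_gt0 s; have rt := radial_gt0 t.
rewrite wedge_circ mulr_ge0 ?(ltW (mulr_gt0 rs rt))//.
by apply: sin_ge0_pi; apply/andP; split; lra.
Qed.

Lemma wedge_circ_gt0 s t : s < t -> t < s + pi ->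
  0 < wedge (circ N s) (circ N t).
Proof.
move=> st tpi; have rs := radial_gt0 s; have rt := radial_gt0 t.
rewrite wedge_circ mulr_gt0 ?mulr_gt0//.
by apply: sin_gt0_pi; apply/andP; split; lra.
Qed.

Lemma wedgeC v w : wedge v w = - wedge w v.
Proof. by rewrite /wedge; ring. Qed.

(** In the quadrilateral [0, z, y, x] with [y = l x + m z], the diagonals, from
    [0] to [y] and from [z] to [x], cross at [y / (l + m)], so by two triangle
    inequalities their total length is at least that of the opposite sides, from
    [0] to [z] and from [y] to [x].  Since [y] and [z] have the same norm, this
    leaves [N (x - y) <= N (x - z)]. *)
Lemma chord_le x z (l m : R) : N x = 1 -> N z = 1 -> 0 <= l -> 0 <= m ->
  N (l *: x + m *: z) = 1 -> N (x - (l *: x + m *: z)) <= N (x - z).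
Proof.
have [NZ ND _] := hN; move=> Nx Nz l0 m0 Ny.
have lm : 1 <= l + m.
  rewrite -Ny; apply: le_trans (ND _ _) _.
  by rewrite !plane_normZ_ge0// Nx Nz; lra.
(* [y / k] is the crossing point of the diagonals *)
set y := l *: x + m *: z in Ny *; set k := l + m in lm.
have k0 : 0 < k by lra.
have h1 : N (x - y) <= N (k^-1 *: (m *: (x - z))) + N ((1 - k^-1) *: y).
  have -> : x - y = k^-1 *: (m *: (x - z)) - (1 - k^-1) *: y.
    rewrite /y; case: x z {Nx Nz Ny y} => [x1 x2] [z1 z2].
    apply/pair_equal_spec; rewrite /= /GRing.scale /=.
    by rewrite /k; split; field; apply/eqP => E; move: k0; rewrite /k E ltxx.
  by rewrite -[N ((1 - _) *: _)]plane_normN; exact: ND.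
have h2 : N z <= N (k^-1 *: (l *: (x - z))) + N (k^-1 *: y).
  have {1}-> : z = - (k^-1 *: (l *: (x - z))) + k^-1 *: y.
    rewrite /y; case: x z {Nx Nz Ny h1 y} => [x1 x2] [z1 z2].
    apply/pair_equal_spec; rewrite /= /GRing.scale /=.
    by rewrite /k; split; field; apply/eqP => E; move: k0; rewrite /k E ltxx.
  by rewrite -[N (k^-1 *: (l *: _))]plane_normN; exact: ND.
have ki0 : 0 <= k^-1 by rewrite invr_ge0 ltW.
have ki1 : k^-1 <= 1 by rewrite invf_le1.
rewrite !plane_normZ_ge0 ?subr_ge0// Ny in h1.
rewrite !plane_normZ_ge0// Ny Nz in h2.
have -> : N (x - z) = k^-1 * (m * N (x - z)) + k^-1 * (l * N (x - z)).
  by rewrite -mulrDr -mulrDl [m + l]addrC -/k mulKf// gt_eqF.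
lra.
Qed.

End Plane.

(** * One-sided tangents *)

Lemma near0_ex {R : realType} (P : R -> Prop) :
  (\forall h \near (0 : R), P h) ->
  exists2 h0, 0 < h0 & forall h, `|h| <= h0 -> P h.
Proof.
move=> /nbhs_ballP[e /= e0 eP]; exists (e / 2); first by rewrite divr_gt0.
move=> h hh; apply: eP; rewrite /ball /= sub0r normrN; lra.
Qed.

Section Tangent.
Context {R : realType} {N : R^o * R^o -> R} (hN : plane_norm N).
Implicit Types (v w x z : R^o * R^o) (s t u h : R).

(** By convexity the difference quotients of [N] at [x] in the direction [d]
    are nondecreasing in [t], so they tend to their infimum [D] as [t] tends to
    [0].  The functional [l] with value [1] at [x] and [D] at [d] lies below
    [N]: at [a x + b d] with [b > 0] this is the definition of [D] as a lower
    bound, after adding a multiple of [x] to make [a] positive; for [b < 0] it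
    follows by the triangle inequality from an upper bound on the opposite
    side. *)
Lemma support_right x d : N x = 1 -> wedge x d != 0 ->
  exists l, [/\ forall v, pairing l v <= N v, pairing l x = 1 &
    forall eta : R, 0 < eta -> exists2 t0, 0 < t0 & forall t, 0 < t <= t0 ->
      0 <= (N (x + t *: d) - 1) / t - pairing l d <= eta].
Proof.
have [_ ND _] := hN; move=> Nx w0.
pose Q t := (N (x + t *: d) - 1) / t.
have Qmono t t' : 0 < t -> t <= t' -> Q t <= Q t'.
  move=> t_gt0 tt'; have t'0 : 0 < t' by lra.
  have k1 : t / t' <= 1 by rewrite ler_pdivrMr// mul1r.
  have k0 : 0 <= t / t' by rewrite divr_ge0// ltW.
  have E : x + t *: d = (1 - t / t') *: x + (t / t') *: (x + t' *: d).
    rewrite scalerDr scalerA addrA -scalerDl subrK scale1r.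
    by rewrite divfK// gt_eqF.
  rewrite /Q ler_pdivrMr//.
  have -> : (N (x + t' *: d) - 1) / t' * t = t / t' * N (x + t' *: d) - t / t'.
    by rewrite mulrAC -mulrA mulrC mulrBr mulr1.
  rewrite {1}E; have := ND ((1 - t / t') *: x) ((t / t') *: (x + t' *: d)).
  by rewrite !(plane_normZ_ge0 hN) ?subr_ge0// Nx mulr1; lra.
have Qlb t : 0 < t -> - N d <= Q t.
  move=> t0; rewrite ler_pdivlMr//.
  have := plane_normB_le hN x (- (t *: d)).
  by rewrite opprK (plane_normN hN)// (plane_normZ_gt0 hN)// Nx; lra.
pose A := [set Q t | t in [set t | 0 < t]].
have hA : has_inf A.
  split; first by exists (Q 1), 1 => //=.
  by exists (- N d) => _ [t t0 <-]; exact: Qlb.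
pose D := inf A.
have DQ t : 0 < t -> D <= Q t by move=> t0; apply: ge_inf; [case: hA|exists t].
have Qdense eta : 0 < eta ->
    exists2 t0, 0 < t0 & forall t, 0 < t <= t0 -> Q t <= D + eta.
  move=> eta0; have [_ [t0 t00 <-] tlt] := inf_adherent eta0 hA.
  exists t0 => // t /andP[tp tt0].
  exact: le_trans (Qmono _ _ tp tt0) (ltW tlt).
pose l : R^o * R^o :=
  ((d.2 - D * x.2) / wedge x d, (D * x.1 - d.1) / wedge x d).
have lx : pairing l x = 1.
  by move: w0; rewrite /pairing /l /wedge /= => w0; field.
have ld : pairing l d = D.
  by move: w0; rewrite /pairing /l /wedge /= => w0; field.
exists l; split => //; last first.
  move=> eta /Qdense[t0 t00 h]; exists t0 => // t /andP[tp tt0].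
  by rewrite ld subr_ge0 DQ//= lerBlDl h// tp.
move=> v; rewrite (wedge_decomp x d v w0).
move: (wedge v d / _) (wedge x v / _) => a b.
rewrite pairingD !pairingZ lx ld mulr1.
have [b0|b0|<-] := ltgtP 0 b.
- set k := `|a| + 1; have ka : 0 < a + k.
    by have := ler_norm (- a); rewrite normrN /k; lra.
  have k0 : 0 < k by rewrite ltr_wpDl.
  have := ND (a *: x + b *: d) (k *: x); rewrite addrAC -scalerDl.
  have -> : (a + k) *: x + b *: d = (a + k) *: (x + (b / (a + k)) *: d).
    by rewrite scalerDr scalerA mulrC divfK// gt_eqF.
  rewrite !(plane_normZ_gt0 hN)// Nx.
  have := DQ (b / (a + k)); rewrite divr_gt0// => /(_ isT).
  rewrite /Q ler_pdivlMr ?divr_gt0//.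
  rewrite mulrA ler_pdivrMr//; lra.
- apply/ler_addgt0Pr => e e0.
  have eb0 : 0 < e / - b by rewrite divr_gt0// oppr_gt0.
  have [t0 t00 ht] := Qdense _ eb0.
  have bt0 : 0 < - b / t0 by rewrite divr_gt0// oppr_gt0.
  have [k [ka k0 bk]] : exists k, [/\ 0 < a + k, 0 < k & - b / t0 <= k].
    exists (`|a| + 1 + - b / t0); have := ler_norm (- a).
    by have := normr_ge0 a; rewrite normrN; split; lra.
  have tk : 0 < - b / k <= t0.
    by rewrite divr_gt0 ?oppr_gt0//= ler_pdivrMr// mulrC -ler_pdivrMr.
  have := ht _ tk; have /andP[tk0 _] := tk.
  rewrite /Q ler_pdivrMr// => h.
  have := ND (a *: x + b *: d) (k *: x + - b *: d).
  have -> : a *: x + b *: d + (k *: x + - b *: d) = (a + k) *: x.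
    by rewrite addrACA -!scalerDl subrr scale0r addr0.
  have -> : k *: x + - b *: d = k *: (x + (- b / k) *: d).
    by rewrite scalerDr scalerA mulrC divfK// gt_eqF.
  rewrite !(plane_normZ_gt0 hN)// Nx mulr1.
  have : k * N (x + (- b / k) *: d) <= k + - b * D + e.
    have -> : k + - b * D + e = k * (1 + (D + e / - b) * (- b / k)).
      by field; rewrite (lt0r_neq0 k0) (ltr0_neq0 b0).
    by rewrite ler_pM2l//; lra.
  lra.
- rewrite mul0r scale0r !addr0; have [NZ _ _] := hN.
  by rewrite NZ Nx mulr1 ler_norm.
Qed.

(** Here [h >= 0] moves [x] counterclockwise to [x1], and [l] supports the unit
    disc at [x] along its counterclockwise tangent.  For
    [x1 = la x + mu d], the linear functional equal to [1] at both [x] and [x1]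
    takes at [d] the value [(1 - la) / mu], which is exactly the difference
    quotient of [N] at [x] in the direction [d] with step [mu / la]; so
    [support_right] says that secant functionals tend to [l]. *)
Lemma support_secant t : exists l, [/\ forall v, pairing l v <= N v,
  pairing l (circ N t) = 1 & forall v (eta : R), 0 < eta ->
  \forall h \near (0 : R), 0 <= h ->
    `|wedge v (circ N (t + h) - circ N t)
      - pairing l v * wedge (circ N t) (circ N (t + h))|
    <= eta * wedge (circ N t) (circ N (t + h))].
Proof.
pose x := circ N t; pose d : R^o * R^o := (- sin t, cos t).
have r0 := radial_gt0 hN t.
have xd : wedge x d = radial N t.
  rewrite /x /d /circ /wedge /= /GRing.scale /= -[RHS]mulr1 -(cos2Dsin2 t).
  ring.
have xd0 : wedge x d != 0 by rewrite xd gt_eqF.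
have [l [lN lx lt]] := support_right x d (circ_norm hN t) xd0.
exists l; split => // v eta eta0.
pose b := wedge x v / wedge x d.
have b1 : 0 < `|b| + 1 by rewrite ltr_wpDl.
have eb : 0 < eta / (`|b| + 1) by rewrite divr_gt0.
have [t0 t00 htt] := lt _ eb.
(* [near1] says that the step [mu / la], which is [radial N t * tan h], is
   below [t0] *)
have near1 : \forall h \near (0 : R), radial N t * sin h - t0 * cos h < 0.
  have : (fun h => radial N t * sin h - t0 * cos h) @ (0 : R)
      --> radial N t * sin 0 - t0 * cos 0.
    apply: cvgB; apply: cvgMr; [exact: continuous_sin|exact: continuous_cos].
  by move/cvgr_lt; apply; rewrite sin0 cos0; lra.
have near2 : \forall h \near (0 : R), 0 < cos h.
  have : cos @ (0 : R) --> cos (0 : R) by exact: continuous_cos.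
  by move/cvgr_gt; apply; rewrite cos0; lra.
have near3 : \forall h \near (0 : R), h < pi.
  by apply: lt_nbhsl; exact: pi_gt0.
near=> h => h0; rewrite -/x.
move: h0; rewrite le_eqVlt => /predU1P[<-|h0].
  have W0 : wedge x x = 0 by rewrite /wedge; ring.
  have V0 : wedge v (x - x) = 0 by rewrite /wedge /=; ring.
  by rewrite addr0 -/x W0 V0 !mulr0 subr0 normr0.
have sh : 0 < sin h.
  by apply: sin_gt0_pi; rewrite h0 /=; near: h; exact: near3.
have ch : 0 < cos h by near: h.
have hsc : radial N t * sin h - t0 * cos h < 0 by near: h.
pose la := radial N (t + h) * cos h / radial N t.
pose mu := radial N (t + h) * sin h.
have r1 := radial_gt0 hN (t + h).
have mu0 : 0 < mu by rewrite mulr_gt0.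
have la0 : 0 < la by rewrite divr_gt0// mulr_gt0.
have x1E : circ N (t + h) = la *: x + mu *: d.
  rewrite /circ /la /mu /x /circ /d; apply/pair_equal_spec.
  by rewrite /= /GRing.scale /= cosD sinD; split; field; rewrite gt_eqF.
have wx : wedge x (circ N (t + h)) = mu * radial N t.
  by rewrite x1E -xd /wedge /= /GRing.scale /=; ring.
have Nla : la * N (x + (mu / la) *: d) = 1.
  rewrite -(plane_normZ_gt0 hN)// scalerDr scalerA mulrC divfK ?gt_eqF//.
  by rewrite -x1E circ_norm.
have tin : 0 < mu / la <= t0.
  rewrite divr_gt0//= ler_pdivrMr// /la /mu.
  have -> : t0 * (radial N (t + h) * cos h / radial N t)
      = radial N (t + h) * (t0 * cos h / radial N t) by ring.
  by rewrite ler_pM2l// ler_pdivlMr//; lra.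
have /andP[h1 h2] := htt _ tin.
set Q := (_ - 1) / _ in h1 h2.
have QE : Q = (1 - la) / mu.
  rewrite /Q; have -> : N (x + (mu / la) *: d) = la^-1.
    by apply: (mulfI (lt0r_neq0 la0)); rewrite Nla divff// gt_eqF.
  by field; rewrite !gt_eqF.
have -> : wedge v (circ N (t + h) - x)
    - pairing l v * wedge x (circ N (t + h)) =
    b * (Q - pairing l d) * (mu * radial N t).
  rewrite wx QE /b; set a := wedge v d / wedge x d.
  have -> : pairing l v = a + wedge x v / wedge x d * pairing l d.
    by rewrite {1}(wedge_decomp x d v xd0) pairingD (pairingZ l _ x) lx mulr1
      (pairingZ l _ d).
  have -> : wedge v (circ N (t + h) - x) =
     a * (mu * radial N t) + wedge x v / wedge x d * ((1 - la) * radial N t).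
    rewrite {1}(wedge_decomp x d v xd0) -/a x1E -xd; set c := wedge x v / _.
    by rewrite /wedge /= /GRing.scale /=; ring.
  by field; rewrite !gt_eqF// xd.
have mr0 : 0 < mu * radial N t by rewrite mulr_gt0.
rewrite wx 2!normrM [`|Q - _|]ger0_norm// (gtr0_norm mr0) ler_pM2r//.
apply: (@le_trans _ _ (`|b| * (eta / (`|b| + 1)))); first by rewrite ler_wpM2l.
rewrite mulrCA ler_piMr ?ltW//.
by rewrite ltr_pdivrMr//; lra.
Unshelve. all: by end_near. Qed.

End Tangent.

(** * Sector area *)

Lemma antiderivative_on {R : realType} (f : R -> R) (a b : R) : continuous f ->
  exists S : R -> R, forall x, a < x < b -> is_derive x 1 S (f x).
Proof.
move=> cf; exists (fun x => (\int[lebesgue_measure]_(t in `[a, x]) f t)%R).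
move=> x /andP[ax xb].
have fi : (@lebesgue_measure R).-integrable `[a, b] (EFin \o f).
  apply: continuous_compact_integrable; first exact: segment_compact.
  exact: continuous_subspaceT.
have [dF F'] := continuous_FTC1_closed xb fi ax (cf x).
by apply: DeriveDef => //; rewrite -derive1E.
Qed.

Section Potential.
Context {R : realType} {N : R^o * R^o -> R} (hN : plane_norm N).
Implicit Types (s t u h : R).

(** [radial N t ^+ 2] is the density, in polar angle, of twice the sector area;
    near [t] the sector and the inscribed triangle agree to first order. *)
Lemma potential_wedge (S : R -> R) t : is_derive t 1 S (radial N t ^+ 2) ->
  forall eta : R, 0 < eta -> \forall h \near (0 : R),
    `|S (t + h) - S t - wedge (circ N t) (circ N (t + h))|
    <= eta * `|wedge (circ N t) (circ N (t + h))|.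
Proof.
move=> dS eta eta0; have r0 := radial_gt0 hN t.
have cS : (fun h => (S (t + h) - S t) / h) @ (0 : R)^' --> radial N t ^+ 2.
  have [dS1 dS2] := dS; rewrite -dS2.
  have : (fun h => h^-1 *: (S (h *: 1 + t) - S t)) @ (0 : R)^' --> 'D_1 S t.
    exact: dS1.
  apply: cvg_trans; apply: near_eq_cvg; near=> h.
  by rewrite /GRing.scale /= mulr1 [h + t]addrC [h^-1 * _]mulrC.
have cs : (fun h => sin h / h) @ (0 : R)^' --> (1 : R).
  have [dS1 dS2] : is_derive (0 : R) 1 sin (cos 0) by exact: is_derive_sin.
  rewrite -(@cos0 R) -dS2.
  have : (fun h => h^-1 *: (sin (h *: 1 + 0) - sin 0)) @ (0 : R)^' -->
      'D_1 sin (0 : R) by exact: dS1.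
  apply: cvg_trans; apply: near_eq_cvg; near=> h.
  by rewrite /GRing.scale /= mulr1 addr0 sin0 subr0 [h^-1 * _]mulrC.
have cr : (fun h => radial N (t + h)) @ (0 : R)^' --> radial N t.
  have : (fun h => radial N (t + h)) @ (0 : R) --> radial N (t + 0).
    apply: (@continuous_comp _ _ _ (fun h => t + h) (radial N) 0); last first.
      exact: radial_continuous.
    by apply: cvgD; [exact: cvg_cst|exact: cvg_id].
  by rewrite addr0; apply: cvg_trans; apply: cvg_app; exact: nbhs_dnbhs.
pose m h := radial N t * radial N (t + h) * (sin h / h).
have cm : m @ (0 : R)^' --> radial N t ^+ 2.
  rewrite expr2 -[X in _ --> X]mulr1; apply: cvgM => //.
  by apply: cvgM => //; exact: cvg_cst.
have cq : (fun h => (S (t + h) - S t) / h - m h) @ (0 : R)^' --> (0 : R).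
  by rewrite -[X in _ --> X](subrr (radial N t ^+ 2)); exact: cvgB.
have r20 : 0 < radial N t ^+ 2 by rewrite exprn_gt0.
have near1 : \forall h \near (0 : R)^', radial N t ^+ 2 / 2 < m h.
  by move/cvgr_gt : cm; apply; lra.
have near2 : \forall h \near (0 : R)^',
    `|(S (t + h) - S t) / h - m h| < eta * (radial N t ^+ 2 / 2).
  have := cvgr0_norm_lt _ cq; apply.
  by rewrite mulr_gt0// divr_gt0.
have nh : \forall h \near (0 : R), h != 0 ->
    `|S (t + h) - S t - wedge (circ N t) (circ N (t + h))|
    <= eta * `|wedge (circ N t) (circ N (t + h))|.
  suff : \forall h \near (0 : R)^', `|S (t + h) - S t
    - wedge (circ N t) (circ N (t + h))|
    <= eta * `|wedge (circ N t) (circ N (t + h))| by exact.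
  near=> h; have h0 : h != 0 by near: h; exact: nbhs_dnbhs_neq.
  have wE : wedge (circ N t) (circ N (t + h)) = m h * h.
    by rewrite wedge_circ /m [t + h]addrC addrK -[RHS]mulrA divfK.
  have SE : S (t + h) - S t = (S (t + h) - S t) / h * h by rewrite divfK.
  have m1 : radial N t ^+ 2 / 2 < m h by near: h.
  have q1 : `|(S (t + h) - S t) / h - m h| < eta * (radial N t ^+ 2 / 2).
    by near: h.
  rewrite wE SE -mulrBl normrM [`|m h * h|]normrM mulrA ler_wpM2r//.
  by rewrite (le_trans (ltW q1))// ler_wpM2l ?ltW// (lt_le_trans m1)// ler_norm.
near=> h.
have [->|h0] := eqVneq h 0; last by move: h0; near: h.
by rewrite addr0 subrr wedge_circ subrr sin0 mulr0 subr0 normr0 mulr0.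
Unshelve. all: by end_near. Qed.

End Potential.

(** * Chords of a given length *)

(** Angles [s], [t], [u] of [x], [z], [w] with [x - z = e w].  The inequalities
    select the lifts of the three angles: [z] is behind [x] by at most half a
    turn, and [w], a positive combination of [x] and [- z], lies between them.
    Recording [u] as data makes the conditions closed and avoids a continuous
    choice of the argument of [w]. *)
Definition chord_triple {R : realType} (N : R^o * R^o -> R) (e s t u : R) :=
  [/\ t <= s, s <= u, u <= t + pi & circ N s - circ N t = e *: circ N u].

Section Chord.
Context {R : realType} {N : R^o * R^o -> R} (hN : plane_norm N).
Implicit Types (s t u h : R).

Lemma circ_between a b c : a <= b -> b <= c -> a < c -> c < a + pi ->
  exists l m : R,
    [/\ 0 <= l, 0 <= m & circ N b = l *: circ N a + m *: circ N c].
Proof.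
move=> ab bc ac cpi.
have w0 := wedge_circ_gt0 hN a c ac cpi.
exists (wedge (circ N b) (circ N c) / wedge (circ N a) (circ N c)).
exists (wedge (circ N a) (circ N b) / wedge (circ N a) (circ N c)).
split; last by apply: wedge_decomp; rewrite gt_eqF.
- by rewrite divr_ge0 ?(ltW w0)// wedge_circ_ge0//; lra.
- by rewrite divr_ge0 ?(ltW w0)// wedge_circ_ge0//; lra.
Qed.

Lemma chord_mono_right a b c : a <= b -> b <= c -> a < c -> c < a + pi ->
  N (circ N c - circ N b) <= N (circ N c - circ N a).
Proof.
move=> ab bc ac cpi; have [l [m [l0 m0 E]]] := circ_between a b c ab bc ac cpi.
have := chord_le hN (circ N c) (circ N a) m l.
by rewrite !(circ_norm hN) addrC -E (circ_norm hN); exact.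
Qed.

Lemma chord_mono_left a b c : a <= b -> b <= c -> a < c -> c < a + pi ->
  N (circ N b - circ N a) <= N (circ N c - circ N a).
Proof.
move=> ab bc ac cpi; have [l [m [l0 m0 E]]] := circ_between a b c ab bc ac cpi.
have := chord_le hN (circ N a) (circ N c) l m.
rewrite !(circ_norm hN) -E (circ_norm hN) (plane_normC hN (circ N b)).
by rewrite (plane_normC hN (circ N c)); exact.
Qed.

Lemma wedge_continuous_r (v : R^o * R^o) :
  continuous (fun u => wedge v (circ N u)).
Proof.
have -> : (fun u => wedge v (circ N u)) =
    (fun u => radial N u * (v.1 * sin u - v.2 * cos u)).
  by apply/funext => u; rewrite /wedge /circ /= /GRing.scale /=; ring.
move=> u; apply: cvgM; first exact: radial_continuous.
by apply: cvgB; apply: cvgMr; [exact: continuous_sin|exact: continuous_cos].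
Qed.

(** Finds the angle of [x - z] between prescribed bounds [a] and [b], at
    which the circle lies on different sides of the line through [x - z]: over
    the whole range from [s] to [t + pi] this gives existence, over a small
    interval it gives continuity of the angle. *)
Lemma chord_direction e s t a b : 0 < e -> t < s -> s < t + pi ->
  s <= a -> a <= b -> b <= t + pi -> N (circ N s - circ N t) = e ->
  wedge (circ N s - circ N t) (circ N a) <= 0 ->
  0 <= wedge (circ N s - circ N t) (circ N b) ->
  exists u, [/\ a <= u, u <= b & circ N s - circ N t = e *: circ N u].
Proof.
move=> e0 ts stp sa ab btp; set W := circ N s - circ N t => NW wa wb.
have [u uab wu] : exists2 u, u \in `[a, b]%R & wedge W (circ N u) = 0.
  apply: (@IVT _ (fun u => wedge W (circ N u)) a b 0) => //.
    by apply: continuous_subspaceT; exact: wedge_continuous_r.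
  by rewrite ge_min wa /= le_max wb orbT.
have /andP[au ub] : a <= u <= b by move: uab; rewrite in_itv.
exists u; split => //.
pose d : R^o * R^o := (- sin u, cos u).
have cd : wedge (circ N u) d = radial N u.
  rewrite /d /circ /wedge /= /GRing.scale /= -[RHS]mulr1 -(cos2Dsin2 u).
  ring.
have ru := radial_gt0 hN u.
have cd0 : wedge (circ N u) d != 0 by rewrite cd gt_eqF.
have [k WE] : exists k : R, W = k *: circ N u.
  exists (wedge W d / wedge (circ N u) d).
  rewrite [LHS](wedge_decomp _ _ _ cd0).
  have -> : wedge (circ N u) W = - wedge W (circ N u) by rewrite /wedge; ring.
  by rewrite wu oppr0 mul0r scale0r addr0.
have xW : wedge (circ N s) W = wedge (circ N t) (circ N s).
  by rewrite /W /wedge /=; ring.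
have xW0 : 0 < wedge (circ N s) W by rewrite xW wedge_circ_gt0//; lra.
have xWE : wedge (circ N s) W = k * wedge (circ N s) (circ N u).
  by rewrite WE /wedge /= /GRing.scale /=; ring.
have su0 : 0 <= wedge (circ N s) (circ N u).
  by rewrite wedge_circ_ge0//; lra.
(* [k] is positive because both [x - z] and the point at [u] are at most half a
   turn ahead of [x] *)
have k0 : 0 < k.
  rewrite ltNge; apply/negP => k0; move: xW0; rewrite xWE ltNge.
  by rewrite mulr_le0_ge0.
suff <- : k = e by [].
by rewrite -NW WE (plane_normZ_gt0 hN)// (circ_norm hN) mulr1.
Qed.

Lemma chord_triple_lt {e s t u} : 0 < e < 2 -> chord_triple N e s t u ->
  [/\ t < s, s < u & u < t + pi].
Proof.
move=> /andP[e0 e2] [ts su ut E].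
have NE : N (circ N s - circ N t) = e.
  by rewrite E (plane_normZ_gt0 hN)// (circ_norm hN) mulr1.
have ts' : t < s.
  rewrite lt_neqAle ts andbT; apply/eqP => st; move: NE.
  by rewrite st subrr (plane_norm0 hN); lra.
have stp : s < t + pi.
  rewrite lt_neqAle (le_trans su ut) andbT; apply/eqP => st; move: NE.
  rewrite st (circDpi hN) -opprD (plane_normN hN) -mulr2n -scaler_nat.
  by rewrite (plane_normZ_gt0 hN)// (circ_norm hN); lra.
have w0 : 0 < wedge (circ N t) (circ N s) by rewrite wedge_circ_gt0//; lra.
split => //.
- rewrite lt_neqAle su andbT; apply/eqP => su'; move: w0.
  have -> : wedge (circ N t) (circ N s) =
      - wedge (circ N s - circ N t) (circ N s) by rewrite /wedge /=; ring.
  have -> : wedge (circ N s - circ N t) (circ N s) = 0.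
    by rewrite E -su' /wedge /= /GRing.scale /=; ring.
  by rewrite oppr0 ltxx.
- rewrite lt_neqAle ut andbT; apply/eqP => ut'; move: w0.
  have -> : wedge (circ N t) (circ N s) =
      wedge (circ N s - circ N t) (circ N u).
    by rewrite ut' (circDpi hN) /wedge /=; ring.
  have -> : wedge (circ N s - circ N t) (circ N u) = 0.
    by rewrite E /wedge /= /GRing.scale /=; ring.
  by rewrite ltxx.
Qed.

Lemma chord_triple_ex e s : 0 < e < 2 -> exists t u, chord_triple N e s t u.
Proof.
move=> /andP[e0 e2].
have pi0 := pi_gt0 R.
have csp : circ N (s - pi) = - circ N s.
  by rewrite -[in RHS](subrK pi s) (circDpi hN) opprK.
have N2 : N (circ N s - circ N (s - pi)) = 2.
  rewrite csp opprK -mulr2n -scaler_nat.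
  by rewrite (plane_normZ_gt0 hN)// (circ_norm hN) mulr1.
have [t tin Nt] : exists2 t, t \in `[s - pi, s]%R & N (circ N s - circ N t) = e.
  apply: (@IVT _ (fun t => N (circ N s - circ N t)) (s - pi) s e); first by lra.
    apply: continuous_subspaceT => t; apply: continuous_comp.
      by apply: cvgB; [exact: cvg_cst|exact: circ_continuous].
    exact: plane_norm_continuous.
  by rewrite subrr (plane_norm0 hN) N2 ge_min le_max (ltW e0) (ltW e2) orbT.
have /andP[spt ts] : s - pi <= t <= s by move: tin; rewrite in_itv.
have ts' : t < s.
  rewrite lt_neqAle ts andbT; apply/eqP => st; move: Nt.
  by rewrite st subrr (plane_norm0 hN); lra.
have spt' : s - pi < t.
  rewrite lt_neqAle spt andbT; apply/eqP => st; move: Nt.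
  by rewrite -st N2; lra.
have w0 : 0 < wedge (circ N t) (circ N s) by rewrite wedge_circ_gt0//; lra.
have [| | | |u [su ut E]] :=
  chord_direction e s t s (t + pi) e0 ts' _ (lexx _) _ (lexx _) Nt.
- lra.
- lra.
- have -> : wedge (circ N s - circ N t) (circ N s) =
     - wedge (circ N t) (circ N s) by rewrite /wedge /=; ring.
  by lra.
- rewrite (circDpi hN).
  have -> : wedge (circ N s - circ N t) (- circ N t) =
      wedge (circ N t) (circ N s) by rewrite /wedge /=; ring.
  exact: ltW.
by exists t, u; split => //; lra.
Qed.

End Chord.

(** * Moving a chord counterclockwise *)

Section Local.
Context {R : realType} {N : R^o * R^o -> R} (hN : plane_norm N).
Implicit Types (s t u h : R).

(** Advancing [t0] alone by [h] makes the chord no longer, advancing [s0] alone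
    by [h] makes it no shorter, so the intermediate value theorem finds the
    right length on the segment joining these two positions.  The segment avoids
    the initial position, where nothing has moved.  This works even when the
    chord with a given end is not unique. *)
Lemma chord_move {e s0 t0 u0} : 0 < e < 2 -> chord_triple N e s0 t0 u0 ->
  forall d, 0 < d -> exists2 h0, 0 < h0 & forall h, 0 < h <= h0 ->
  exists s t u, [/\ chord_triple N e s t u, s0 <= s, t0 <= t,
    (s - s0) + (t - t0) = h & `|u - u0| <= d].
Proof.
move=> he T0 d d0; have /andP[e0 e2] := he.
have [ts su ut] := chord_triple_lt hN he T0.
have [_ _ _ E0] := T0.
have N0 : N (circ N s0 - circ N t0) = e.
  by rewrite E0 (plane_normZ_gt0 hN)// (circ_norm hN) mulr1.
have [d' [d'0 d'd d's d't]] : exists d', [/\ 0 < d', d' <= d,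
    d' <= (u0 - s0) / 2 & d' <= (t0 + pi - u0) / 2].
  exists (Num.min d (Num.min ((u0 - s0) / 2) ((t0 + pi - u0) / 2))).
  rewrite !lt_min !ge_min !lexx !orbT /=; split => //.
  by rewrite d0 /=; apply/andP; split; lra.
pose F c (p : R * R) := wedge (circ N p.1 - circ N p.2) (circ N c).
have Fc c : continuous (F c).
  have -> : F c = (fun p => - wedge (circ N c) (circ N p.1)
                            + wedge (circ N c) (circ N p.2)).
    by apply/funext => p; rewrite /F /wedge /=; ring.
  move=> p; apply: cvgD; first apply: cvgN.
    apply: (@continuous_comp _ _ _ fst (fun u => wedge (circ N c) (circ N u))).
      exact: cvg_fst.
    exact: wedge_continuous_r.
  apply: (@continuous_comp _ _ _ snd (fun u => wedge (circ N c) (circ N u))).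
    exact: cvg_snd.
  exact: wedge_continuous_r.
have FE c : F c (s0, t0) = e * wedge (circ N u0) (circ N c).
  by rewrite /F /= E0 /wedge /= /GRing.scale /=; ring.
have Fm : F (u0 - d') (s0, t0) < 0.
  rewrite FE wedgeC mulrN oppr_lt0 mulr_gt0// wedge_circ_gt0//; lra.
have Fp : 0 < F (u0 + d') (s0, t0).
  rewrite FE mulr_gt0// wedge_circ_gt0//; lra.
have /nbhs_ballP[r /= r0 hr] : \forall p \near (s0, t0),
    F (u0 - d') p < 0 /\ 0 < F (u0 + d') p.
  near=> p; split; near: p.
    exact: (cvgr_lt _ (Fc (u0 - d') (s0, t0))).
  exact: (cvgr_gt _ (Fc (u0 + d') (s0, t0))).
(* [h0] is small enough for the two signs to persist and for the angles
   within [d'] of [u0] to stay between the new [s] and [t + pi] *)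
have [h0 [h00 h0r h0s h0t]] : exists h0, [/\ 0 < h0, h0 < r,
    h0 <= (u0 - s0) / 2 & h0 <= (s0 - t0) / 2].
  exists (Num.min (r / 2) (Num.min ((u0 - s0) / 2) ((s0 - t0) / 2))).
  rewrite !lt_min !ge_min !gt_min !lexx !orbT /=; split => //.
    by rewrite divr_gt0//=; apply/andP; split; lra.
  by apply/orP; left; lra.
exists h0 => // h /andP[hp hh0].
pose f k := N (circ N (s0 + k) - circ N (t0 + h - k)).
have fc : continuous f.
  move=> k; apply: continuous_comp; last exact: plane_norm_continuous.
  apply: cvgB.
    apply: (@continuous_comp _ _ _ (fun k => s0 + k) (circ N)).
      by apply: cvgD; [exact: cvg_cst|exact: cvg_id].
    exact: circ_continuous.
  apply: (@continuous_comp _ _ _ (fun k => t0 + h - k) (circ N)).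
    by apply: cvgB; [exact: cvg_cst|exact: cvg_id].
  exact: circ_continuous.
have f0 : f 0 <= e.
  by rewrite /f addr0 subr0 -N0; apply: (chord_mono_right hN); lra.
have fh : e <= f h.
  by rewrite /f addrK -N0; apply: (chord_mono_left hN); lra.
have [k kin fk] : exists2 k, k \in `[0, h]%R & f k = e.
  apply: (@IVT _ f 0 h e); [by lra|exact: continuous_subspaceT|].
  by rewrite ge_min f0 /= le_max fh orbT.
have /andP[k0 kh] : 0 <= k <= h by move: kin; rewrite in_itv.
have [Gm Gp] : F (u0 - d') (s0 + k, t0 + h - k) < 0 /\
    0 < F (u0 + d') (s0 + k, t0 + h - k).
  apply: hr; split; rewrite /ball /=.
    by rewrite opprD addNKr normrN ger0_norm//; lra.
  rewrite -addrA opprD addNKr normrN ger0_norm; lra.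
have [| | | | |u [u1 u2 Eu]] := chord_direction hN e (s0 + k) (t0 + h - k)
  (u0 - d') (u0 + d') e0 _ _ _ _ _ fk (ltW Gm) (ltW Gp); try lra.
exists (s0 + k), (t0 + h - k), u; split => //; try lra.
  by split => //; lra.
by rewrite ler_distlC; apply/andP; split; lra.
Unshelve. all: by end_near. Qed.

(** First-order comparison with all errors relative to [X + Z]: up to them,
    [e2 (DX + DZ - 2 DW)] is [(e2 - 2 a) X + (e2 - 2 b) Z], which has the
    sign of [sg]. *)
Lemma increment_ineq (sg e2 a b M del eta X Z W A1 A2 DX DZ DW : R) :
  sg = 1 \/ sg = -1 -> 0 < e2 -> `|a| + eta <= M -> `|b| + eta <= M ->
  0 < eta -> eta * (2 + e2 + 2 * M) < 2 * del ->
  del <= sg * (e2 / 2 - a) -> del <= sg * (e2 / 2 - b) ->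
  0 <= X -> 0 <= Z -> 0 < X + Z -> e2 * W = A1 + A2 ->
  `|A1 - a * X| <= eta * X -> `|A2 - b * Z| <= eta * Z ->
  `|DX - X| <= eta * X -> `|DZ - Z| <= eta * Z -> `|DW - W| <= eta * `|W| ->
  0 < sg * (DX + DZ - 2 * DW).
Proof.
move=> sgE e20 aM bM eta0 etaM da db X0 Z0 XZ WE hA1 hA2 hX hZ hW.
have Aabs (a' A Y : R) : 0 <= Y ->
    `|a'| + eta <= M -> `|A - a' * Y| <= eta * Y ->
    `|A| <= M * Y.
  move=> Y0 a'M hA; rewrite -(subrK (a' * Y) A).
  apply: le_trans (ler_normD _ _) _; rewrite normrM [`|Y|]ger0_norm//.
  have : (`|a'| + eta) * Y <= M * Y by rewrite ler_wpM2r.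
  by rewrite mulrDl; lra.
have WM : e2 * `|W| <= M * (X + Z).
  rewrite -{1}(gtr0_norm e20) -normrM WE; apply: le_trans (ler_normD _ _) _.
  by rewrite mulrDr lerD ?(Aabs a A1 X) ?(Aabs b A2 Z).
have key : eta * (2 + e2 + 2 * M) * (X + Z) < 2 * del * (X + Z).
  by rewrite ltr_pM2r.
have etaW : e2 * (eta * `|W|) <= eta * (M * (X + Z)).
  by rewrite mulrCA ler_wpM2l// ltW.
have dX : del * X <= sg * (e2 / 2 - a) * X by rewrite ler_wpM2r.
have dZ : del * Z <= sg * (e2 / 2 - b) * Z by rewrite ler_wpM2r.
move: hA1 hA2 hX hZ hW; rewrite !ler_norml.
move=> /andP[a1 a2] /andP[b1 b2] /andP[x1 x2] /andP[z1 z2] /andP[w1 w2].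
have ex1 := ler_wpM2l (ltW e20) x1; have ex2 := ler_wpM2l (ltW e20) x2.
have ez1 := ler_wpM2l (ltW e20) z1; have ez2 := ler_wpM2l (ltW e20) z2.
have ew1 := ler_wpM2l (ltW e20) w1; have ew2 := ler_wpM2l (ltW e20) w2.
rewrite -(pmulr_rgt0 _ e20).
case: sgE => sgE; rewrite sgE in dX dZ *; lra.
Qed.

(** When neither end of the chord satisfies the conclusion of [plane_chord], a
    small counterclockwise move increases [sg] times the potential.  The
    estimate rests on the identity
    [e^2 (w0 /\ w) = (x0 - z0) /\ (x - x0) + (z0 - x0) /\ (z - z0)], whose two
    terms are evaluated by [support_secant]. *)
Lemma potential_increase {e s0 t0 u0} (S : R -> R) (sg : R)
    (l q : R^o * R^o) :
  0 < e < 2 -> chord_triple N e s0 t0 u0 -> sg = 1 \/ sg = -1 ->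
  is_derive s0 1 S (radial N s0 ^+ 2) -> is_derive t0 1 S (radial N t0 ^+ 2) ->
  is_derive u0 1 S (radial N u0 ^+ 2) ->
  (forall v (eta : R), 0 < eta -> \forall h \near (0 : R), 0 <= h ->
    `|wedge v (circ N (s0 + h) - circ N s0)
      - pairing l v * wedge (circ N s0) (circ N (s0 + h))|
    <= eta * wedge (circ N s0) (circ N (s0 + h))) ->
  (forall v (eta : R), 0 < eta -> \forall h \near (0 : R), 0 <= h ->
    `|wedge v (circ N (t0 + h) - circ N t0)
      - pairing q v * wedge (circ N t0) (circ N (t0 + h))|
    <= eta * wedge (circ N t0) (circ N (t0 + h))) ->
  0 < sg * (e ^+ 2 / 2 - pairing l (circ N s0 - circ N t0)) ->
  0 < sg * (e ^+ 2 / 2 - pairing q (circ N t0 - circ N s0)) ->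
  forall d, 0 < d -> exists s t u, [/\ chord_triple N e s t u, s0 <= s,
    s <= s0 + d &
    sg * (S s0 + S t0 - 2 * S u0) < sg * (S s + S t - 2 * S u)].
Proof.
move=> he T0 sgE dSs dSt dSu hl hq a0 b0 d d0; have /andP[e0 e2] := he.
have [ts su ut] := chord_triple_lt hN he T0; have [_ _ _ E0] := T0.
set x0 := circ N s0 in hl a0 b0 E0 *; set z0 := circ N t0 in hq a0 b0 E0 *.
set a := pairing l (x0 - z0) in a0; set b := pairing q (z0 - x0) in b0.
have e20 : 0 < e ^+ 2 by rewrite exprn_gt0.
pose M := `|a| + `|b| + 1.
have M0 : 0 < 2 + e ^+ 2 + 2 * M.
  by have := normr_ge0 a; have := normr_ge0 b; rewrite /M; lra.
have [del [del0 dela delb]] : exists del, [/\ 0 < del,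
    del <= sg * (e ^+ 2 / 2 - a) & del <= sg * (e ^+ 2 / 2 - b)].
  exists (Num.min (sg * (e ^+ 2 / 2 - a)) (sg * (e ^+ 2 / 2 - b))).
  by rewrite lt_min !ge_min !lexx orbT a0 b0.
have [eta [eta0 eta1 etaM]] : exists eta, [/\ 0 < eta, eta <= 1 &
    eta * (2 + e ^+ 2 + 2 * M) < 2 * del].
  exists (Num.min 1 (del / (2 + e ^+ 2 + 2 * M))).
  rewrite lt_min ge_min lexx ltr01 divr_gt0//; split => //.
  apply: (@le_lt_trans _ _ del); last by lra.
  by rewrite -ler_pdivlMr// ge_min lexx orbT.
have [d1 d10 hd1] := near0_ex _ (filterI (hl (x0 - z0) eta eta0)
  (potential_wedge hN S s0 dSs eta eta0)).
have [d2 d20 hd2] := near0_ex _ (filterI (hq (z0 - x0) eta eta0)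
  (potential_wedge hN S t0 dSt eta eta0)).
have [d3 d30 hd3] := near0_ex _ (potential_wedge hN S u0 dSu eta eta0).
have [h0 h00 hmove] := chord_move he T0 d3 d30.
have [h [hp [hh0 hd hh1] [hh2 hpi]]] : exists h, [/\ 0 < h,
    [/\ h <= h0, h <= d & h <= d1] & h <= d2 /\ h < pi].
  exists (Num.min h0 (Num.min d (Num.min d1 (Num.min d2 (pi / 2))))).
  have := pi_gt0 R; rewrite !lt_min !ge_min !gt_min !lexx !orbT => pi0.
  rewrite h00 d0 d10 d20 divr_gt0//; split => //; split => //.
  by rewrite [pi / 2 < pi](_ : _ = true) ?orbT//; lra.
have [|s [t [u [T1 ss tt hst uu]]]] := hmove h; first by rewrite hp.
exists s, t, u; split => //; first lra.
have sE : s = s0 + (s - s0) by rewrite addrC subrK.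
have tE : t = t0 + (t - t0) by rewrite addrC subrK.
have uE : u = u0 + (u - u0) by rewrite addrC subrK.
have [|A1h DXh] := hd1 (s - s0); first by rewrite ger0_norm; lra.
have [|A2h DZh] := hd2 (t - t0); first by rewrite ger0_norm; lra.
have DWh := hd3 (u - u0) uu.
rewrite -sE in A1h DXh; rewrite -tE in A2h DZh; rewrite -uE in DWh.
have X0 : 0 <= wedge x0 (circ N s) by apply: wedge_circ_ge0 => //; lra.
have Z0 : 0 <= wedge z0 (circ N t) by apply: wedge_circ_ge0 => //; lra.
rewrite subr_ge0 in A1h; rewrite subr_ge0 in A2h.
have XZ : 0 < wedge x0 (circ N s) + wedge z0 (circ N t).
  have [s0s|s0s] := ltP s0 s.
    by rewrite ltr_pwDl// (wedge_circ_gt0 hN)//; lra.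
  by rewrite ltr_wpDl// (wedge_circ_gt0 hN)//; lra.
have WE : e ^+ 2 * wedge (circ N u0) (circ N u) =
    wedge (x0 - z0) (circ N s - x0) + wedge (z0 - x0) (circ N t - z0).
  have [_ _ _ E1] := T1.
  have -> : e ^+ 2 * wedge (circ N u0) (circ N u) =
      wedge (e *: circ N u0) (e *: circ N u).
    by rewrite /wedge /= /GRing.scale /=; ring.
  by rewrite -E0 -E1 /wedge /=; ring.
rewrite -subr_gt0 -mulrBr.
have -> : S s + S t - 2 * S u - (S s0 + S t0 - 2 * S u0) =
  (S s - S s0) + (S t - S t0) - 2 * (S u - S u0) by ring.
apply: (@increment_ineq sg (e ^+ 2) a b M del eta (wedge x0 (circ N s))
  (wedge z0 (circ N t)) (wedge (circ N u0) (circ N u))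
  (wedge (x0 - z0) (circ N s - x0)) (wedge (z0 - x0) (circ N t - z0))) => //.
- by have := normr_ge0 b; rewrite /M; lra.
- by have := normr_ge0 a; rewrite /M; lra.
- exact: A1h.
- exact: A2h.
- by rewrite -[X in _ * X]ger0_norm.
- by rewrite -[X in _ * X]ger0_norm.
Qed.

End Local.

(** * Extremal chords *)

Section Extremal.
Context {R : realType} {N : R^o * R^o -> R} (hN : plane_norm N).
Implicit Types (s t u h : R).

Lemma circD2pi t : circ N (t + 2 * pi) = circ N t.
Proof.
have -> : t + 2 * pi = t + pi + pi by ring.
by rewrite !(circDpi hN) opprK.
Qed.

Lemma chord_triple_compact e :
  compact [set p : R * R * R | 0 <= p.1.1 <= 2 * pi /\
    chord_triple N e p.1.1 p.1.2 p.2].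
Proof.
pose B : set (R * R * R) := (`[0, 2 * pi]%classic : set R)
  `*` (`[- pi, 2 * pi]%classic : set R) `*` (`[0, 3 * pi]%classic : set R).
have cB : compact B.
  by apply: compact_setX; [apply: compact_setX|]; exact: segment_compact.
have c1 : continuous (fun p : R * R * R => p.1.1).
  move=> p; apply: (@continuous_comp _ _ _ fst fst); exact: cvg_fst.
have c2 : continuous (fun p : R * R * R => p.1.2).
  by move=> p; apply: (@continuous_comp _ _ _ fst snd);
    [exact: cvg_fst|exact: cvg_snd].
have c3 : continuous (fun p : R * R * R => p.2) by move=> p; exact: cvg_snd.
have closed0 (f : R * R * R -> R) : continuous f -> closed [set p | 0 <= f p].
  by move=> cf; apply: (preimage_closed (fun p _ => cf p) (@closed_ge _ 0)).
have circ_c (f : R * R * R -> R) : continuous f ->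
    continuous (fun p => circ N (f p)).
  move=> cf p; apply: (@continuous_comp _ _ _ f (circ N)); first exact: cf.
  exact: circ_continuous.
pose E (p : R * R * R) := N (circ N p.1.1 - circ N p.1.2 - e *: circ N p.2).
have cE : continuous E.
  move=> p; apply: continuous_comp; last exact: plane_norm_continuous.
  apply: cvgB; first by apply: cvgB; exact: circ_c.
  by apply: cvgZ; [exact: cvg_cst|exact: circ_c].
pose K := [set p : R * R * R | 0 <= p.1.1] `&` [set p | 0 <= 2 * pi - p.1.1]
  `&` [set p | 0 <= p.1.1 - p.1.2] `&` [set p | 0 <= p.2 - p.1.1]
  `&` [set p | 0 <= p.1.2 + pi - p.2] `&` [set p | 0 <= - E p].
have -> : [set p : R * R * R | 0 <= p.1.1 <= 2 * pi /\
    chord_triple N e p.1.1 p.1.2 p.2] = K.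
  have [_ _ N0] := hN.
  apply/seteqP; split => -[[s t] u] /=.
    move=> [/andP[h1 h2] [h3 h4 h5 h6]]; rewrite /K /E /= !subr_ge0.
    by rewrite h6 subrr (plane_norm0 hN) oppr0.
  rewrite /K /E /= !subr_ge0 => -[[[[[h1 h2] h3] h4] h5] h6].
  rewrite h1 h2; split => //; split => //; apply/eqP; rewrite -subr_eq0.
  apply/eqP/N0/eqP; rewrite eq_le (plane_norm_ge0 hN) andbT.
  by rewrite -oppr_ge0.
apply: (subclosed_compact _ cB); last first.
  move=> [[s t] u]; rewrite /K /B /= !subr_ge0 => -[[[[[h1 h2] h3] h4] h5] _].
  by rewrite !in_itv /=; split; [split|]; apply/andP; split; lra.
(do 5 try apply: closedI); apply: closed0 => //.
- by move=> p; apply: cvgB; [exact: cvg_cst|exact: c1].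
- by move=> p; apply: cvgB; [exact: c1|exact: c2].
- by move=> p; apply: cvgB; [exact: c3|exact: c1].
- by move=> p; apply: cvgB; [apply: cvgD; [exact: c2|exact: cvg_cst]|exact: c3].
- by move=> p; apply: cvgN; exact: cE.
Qed.

(** The increment over a full turn is the same constant (twice the area of the
    disc) from every starting angle; hence it cancels in [S s + S t - 2 S u]. *)
Lemma potential_quasiperiodic (S : R -> R) :
  (forall x, - (4 * pi) < x < 8 * pi -> is_derive x 1 S (radial N x ^+ 2)) ->
  forall x, - pi <= x <= pi -> S (x + 2 * pi) - S x = S (2 * pi) - S 0.
Proof.
move=> dS x /andP[x1 x2]; have pi0 := pi_gt0 R.
pose F y := S (y + 2 * pi) - S y.
have r2 y : radial N (y + 2 * pi) = radial N y.
  have -> : y + 2 * pi = y + pi *+ 2 by rewrite mulr_natl.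
  by rewrite /radial /unit_dir cosD2pi sinD2pi.
have dF y : - (2 * pi) < y < 2 * pi -> is_derive y 1 F 0.
  move=> /andP[y1 y2].
  have d1 : is_derive y 1 S (radial N y ^+ 2).
    by apply: dS; apply/andP; split; lra.
  have d2 : is_derive (y + 2 * pi) 1 S (radial N y ^+ 2).
    by rewrite -r2; apply: dS; apply/andP; split; lra.
  have d3 : is_derive y 1 (fun y => S (y + 2 * pi)) (radial N y ^+ 2).
    have := @is_derive1_comp _ S (fun y => y + 2 * pi) y (radial N y ^+ 2) 1.
    rewrite mulr1; apply => //.
    by rewrite -[X in is_derive _ _ _ X]addr0; exact: is_deriveD.
  by rewrite -(subrr (radial N y ^+ 2)); exact: is_deriveB.
have cF y : - (2 * pi) < y < 2 * pi -> {for y, continuous F}.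
  by move=> /dF[d _]; apply: differentiable_continuous; exact/derivable1_diffP.
have Fcst a b : a <= b -> - pi <= a -> b <= pi -> F b = F a.
  move=> ab ha hb; apply/eqP; rewrite -subr_eq0; apply/eqP.
  have [||c _ ->] := @MVT_segment _ F (fun=> 0) a b ab; last by rewrite mul0r.
    move=> y; rewrite in_itv /= => /andP[y1 y2].
    by apply: dF; apply/andP; split; lra.
  apply: continuous_in_subspaceT => y; rewrite inE /= in_itv /= => /andP[y1 y2].
  by apply: cF; apply/andP; split; lra.
rewrite -/(F x); have -> : S (2 * pi) - S 0 = F 0 by rewrite /F add0r.
by have [x0|x0] := leP x 0; [symmetry|]; apply: Fcst; lra.
Qed.

(** [sg = 1] gives a chord with [pairing l (x - z) >= e^2 / 2], and [sg = -1]
    one with the reverse inequality. *)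
Theorem plane_chord e (sg : R) : 0 < e < 2 -> sg = 1 \/ sg = -1 ->
  exists x z l, [/\ N x = 1, N z = 1, N (x - z) = e,
    (forall v, pairing l v <= N v) /\ pairing l x = 1 &
    sg * (e ^+ 2 / 2 - pairing l (x - z)) <= 0].
Proof.
move=> he sgE; have pi0 := pi_gt0 R; have /andP[e0 e2] := he.
have cr2 : continuous (fun t => radial N t ^+ 2).
  by move=> t; apply: cvgM; exact: radial_continuous.
have [S dS] := antiderivative_on (fun t => radial N t ^+ 2)
  (- (4 * pi)) (8 * pi) cr2.
have cS x : - (4 * pi) < x < 8 * pi -> {for x, continuous S}.
  by move=> /dS[d _]; apply: differentiable_continuous; exact/derivable1_diffP.
pose K := [set p : R * R * R | 0 <= p.1.1 <= 2 * pi /\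
    chord_triple N e p.1.1 p.1.2 p.2].
pose G (p : R * R * R) := sg * (S p.1.1 + S p.1.2 - 2 * S p.2).
have K0 : K !=set0.
  have [t [u T]] := chord_triple_ex hN e 0 he.
  by exists ((0, t), u); split => //=; apply/andP; split; lra.
have cG : {within K, continuous G}.
  apply: continuous_in_subspaceT => -[[s t] u]; rewrite inE /K /=.
  move=> [/andP[h1 h2] [h3 h4 h5 _]].
  apply: cvgM; first exact: cvg_cst.
  apply: cvgB.
    apply: cvgD.
      apply: (@continuous_comp _ _ _ (fun p : R * R * R => p.1.1) S).
        by apply: (@continuous_comp _ _ _ fst fst); exact: cvg_fst.
      by apply: cS; apply/andP; split => /=; lra.
    apply: (@continuous_comp _ _ _ (fun p : R * R * R => p.1.2) S).
      apply: (@continuous_comp _ _ _ fst snd); first exact: cvg_fst.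
      exact: cvg_snd.
    by apply: cS; apply/andP; split => /=; lra.
  apply: cvgM; first exact: cvg_cst.
  apply: (@continuous_comp _ _ _ snd S); first exact: cvg_snd.
  by apply: cS; apply/andP; split => /=; lra.
have [[[s1 t1] u1]] := compact_EVT_max K0 (chord_triple_compact e) cG.
rewrite inE /K /= => -[/andP[s10 s12] T1] max1.
(* periodicity moves a maximum at [s = 2 pi] back to [s = 0], so that there is
   room to move counterclockwise inside the compact set *)
have [s [t [u [sI T maxG]]]] : exists s t u, [/\ 0 <= s < 2 * pi,
    chord_triple N e s t u & forall p, K p -> G p <= G ((s, t), u)].
  have [s1lt|s1ge] := ltP s1 (2 * pi).
    exists s1, t1, u1; rewrite s10; split => // p Kp.
    by apply: max1; rewrite inE.
  have s1E : s1 = 2 * pi by lra.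
  have [h3 h4 h5 h6] := T1.
  have c2 y : circ N (y - 2 * pi) = circ N y.
    by rewrite -[in RHS](subrK (2 * pi) y) circD2pi.
  exists (s1 - 2 * pi), (t1 - 2 * pi), (u1 - 2 * pi); split.
  - by apply/andP; split; lra.
  - by split; [lra|lra|lra|rewrite !c2].
  - move=> p Kp; apply: le_trans (max1 p _) _; first by rewrite inE.
    have Sq y : pi <= y <= 3 * pi -> S y = S (y - 2 * pi) + (S (2 * pi) - S 0).
      move=> /andP[y1 y2]; rewrite -(potential_quasiperiodic S dS (y - 2 * pi)).
        by rewrite subrK; ring.
      by apply/andP; split; lra.
    rewrite /G /= (Sq s1) ?(Sq t1) ?(Sq u1); last 3 first.
    - by apply/andP; split; lra.
    - by apply/andP; split; lra.
    - by apply/andP; split; lra.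
    by rewrite le_eqVlt; apply/orP; left; apply/eqP; ring.
have /andP[s0 s2] := sI; have [ts su ut] := chord_triple_lt hN he T.
have [_ _ _ E] := T.
have Nst : N (circ N s - circ N t) = e.
  by rewrite E (plane_normZ_gt0 hN)// (circ_norm hN) mulr1.
have [l [lN l1 hl]] := support_secant hN s.
have [q [qN q1 hq]] := support_secant hN t.
have [a0|a0] := leP (sg * (e ^+ 2 / 2 - pairing l (circ N s - circ N t))) 0.
  by exists (circ N s), (circ N t), l; split => //; exact: circ_norm.
have [b0|b0] := leP (sg * (e ^+ 2 / 2 - pairing q (circ N t - circ N s))) 0.
  exists (circ N t), (circ N s), q; split => //; try exact: circ_norm.
  by rewrite (plane_normC hN).
exfalso.
have [| | | |s' ] := potential_increase hN S sg l q he T sgE _ _ _ hl hq a0 b0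
  (2 * pi - s).
- by apply: dS; apply/andP; split; lra.
- by apply: dS; apply/andP; split; lra.
- by apply: dS; apply/andP; split; lra.
- by rewrite subr_gt0.
move=> [t' [u' [T' ss' s'd]]]; rewrite ltNge => /negP; apply.
by apply: (maxG ((s', t'), u')); split => //=; apply/andP; split; lra.
Qed.

End Extremal.

(** * Chords of the unit sphere and the moduli *)

(** At the end points the chords are degenerate: [z = x] for length [0], and
    [z = - x] for length [2]. *)
Lemma plane_chord_closed {R : realType} {N : R^o * R^o -> R}
    (hN : plane_norm N) (e sg : R) : 0 <= e <= 2 -> sg = 1 \/ sg = -1 ->
  exists x z l, [/\ N x = 1, N z = 1, N (x - z) = e,
    (forall v, pairing l v <= N v) /\ pairing l x = 1 &
    sg * (e ^+ 2 / 2 - pairing l (x - z)) <= 0].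
Proof.
move=> /andP[e0 e2] sgE.
have [l [lN lx _]] := support_secant hN 0.
have [eE|e0'] := eqVneq e 0.
  exists (circ N 0), (circ N 0), l; rewrite eE subrr (circ_norm hN).
  by rewrite (plane_norm0 hN) /pairing /= expr0n /=; split => //; lra.
have [eE|e2'] := eqVneq e 2.
  exists (circ N 0), (- circ N 0), l.
  rewrite opprK pairingD lx eE (plane_normN hN) (circ_norm hN).
  have -> : circ N 0 + circ N 0 = 2 *: circ N 0 by rewrite scaler_nat mulr2n.
  rewrite (plane_normZ_gt0 hN)// (circ_norm hN) mulr1; split => //.
  by rewrite expr2; lra.
by apply: (plane_chord hN) => //; rewrite !lt_neqAle eq_sym e0' e0 e2' e2.
Qed.

Lemma J1_of_le {R : realType} {X : normedModType R} (x : X)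
    (p : {linear X -> R^o}) :
  `|x| = 1 -> (forall y, p y <= `|y|) -> p x = 1 -> J1 x p.
Proof.
move=> x1 ple px.
have pabs y : `|p y| <= `|y|.
  rewrite ler_norml ple andbT lerNl; have := ple (- y).
  by rewrite linearN normrN.
split; last by rewrite px x1.
split.
  apply/linear_bounded_continuous/bounded_funP => r; exists r => y yr.
  exact: le_trans (pabs y) yr.
apply/eqP; rewrite eq_le; apply/andP; split.
  apply: ge_sup; first by exists `|p 0|, 0; rewrite //= normr0.
  by move=> _ [y /= y1 <-]; exact: le_trans (pabs y) y1.
apply: ub_le_sup; last by exists x; rewrite /= ?x1 ?px ?normr1.
by exists 1 => _ [y /= y1 <-]; exact: le_trans (pabs y) y1.
Qed.

Lemma J1_le {R : realType} {X : normedModType R} {x : X}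
  {p : {linear X -> R^o}} : J1 x p -> forall y, `|p y| <= `|y|.
Proof.
move=> [[cp dp] _] y.
have [->|y0] := eqVneq y 0; first by rewrite linear0 !normr0.
have y0' : 0 < `|y| by rewrite normr_gt0.
have hb : has_ubound [set `|p x| | x in [set x : X | `|x| <= 1]].
  have [M hM] := (bounded_funP p).2 ((linear_bounded_continuous p).2 cp) 1.
  by exists M => _ [z /= z1 <-]; exact: hM.
have : `|p (`|y|^-1 *: y)| <= 1.
  rewrite -dp; apply: ub_le_sup => //; exists (`|y|^-1 *: y) => //=.
  by rewrite normrZ normfV normr_id mulVf// gt_eqF.
by rewrite linearZ /= normrM normfV normr_id ler_pdivrMl// mulr1.
Qed.

Lemma sphere_chord {R : realType} (X : normedModType R) (e sg : R) :
  dim_ge 2 X -> 0 <= e <= 2 -> sg = 1 \/ sg = -1 ->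
  exists (x z : X) (p : {linear X -> R^o}),
    [/\ unit_sphere x, unit_sphere z, `|x - z| = e, J1 x p &
     sg * (e ^+ 2 / 2 - p (x - z)) <= 0].
Proof.
move=> [b bfree] he sgE.
pose em (v : R^o * R^o) : X := v.1 *: b ord0 + v.2 *: b ord_max.
have emD v w : em (v + w) = em v + em w.
  by rewrite /em /= !scalerDl addrACA.
have emZ (k : R) v : em (k *: v) = k *: em v.
  by rewrite /em /= scalerDr !scalerA.
have emN v : em (- v) = - em v by rewrite -scaleN1r emZ scaleN1r.
pose N v := `|em v|.
have hN : plane_norm N.
  split.
  - by move=> k v; rewrite /N emZ normrZ.
  - by move=> v w; rewrite /N emD ler_normD.
  - move=> [v1 v2] /normr0_eq0 v0.
    have h := bfree (fun i => if i == ord0 then v1 else v2).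
    rewrite big_ord_recl big_ord1 /= in h.
    have e1 : lift ord0 ord0 = ord_max :> 'I_2 by apply: val_inj.
    rewrite e1 in h; have {}h := h v0.
    by have := h ord0; have := h ord_max; rewrite /= => -> ->.
have [x [z [l [Nx Nz Nxz [lN lx] hl]]]] := plane_chord_closed hN e sg he sgE.
(* the graph of the planar functional, transported to [X] *)
pose C : set (X * R) := [set (em v, pairing l v) | v in [set: R^o * R^o]].
have [| | | | |p pN pC] := @hahn_banach_cone R X (fun x => `|x|) C.
- split=> [v w|k v k0]; first exact: ler_normD.
  by rewrite normrZ gtr0_norm.
- by exists 0 => //; rewrite /em /pairing /= !scale0r !mulr0 !addr0.
- move=> _ _ [v _ <-] [w _ <-]; exists (v + w) => //=.
  by rewrite emD pairingD.
- by move=> k _ k0 [v _ <-]; exists (k *: v) => //=; rewrite emZ pairingZ.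
- by move=> _ [v _ <-] /=; exact: lN.
have pE v : p (em v) = pairing l v.
  apply/eqP; rewrite eq_le; apply/andP; split; last first.
    by apply: (pC (em v, pairing l v)); exists v.
  have plN : pairing l (- v) = - pairing l v by rewrite /pairing /=; ring.
  have Cv : C (em (- v), pairing l (- v)) by exists (- v).
  by have := pC _ Cv; rewrite /= emN linearN plN lerN2.
exists (em x), (em z), p; rewrite -emN -emD pE; split => //.
by apply: J1_of_le => //; rewrite pE.
Qed.

(** A support functional at [x] vanishes on the [y] orthogonal to [x]: it obeys
    [1 + t p y <= |x + t y| = sqrt (1 + t^2 |y|^2)] for all [t], whose
    right side is flat at [t = 0].  So [p] is the inner product with [x]. *)
Lemma J1_dot {R : realType} {H : normedModType R} (dot : {dot H for idfun})
    (dot_norm : forall x : H, `|x| ^+ 2 = dot x x) {x z : H}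
    {p : {linear H -> R^o}} :
  unit_sphere x -> unit_sphere z -> J1 x p ->
  p (x - z) = `|x - z| ^+ 2 / 2.
Proof.
rewrite /unit_sphere /= => x1 z1 pJ; have pabs := J1_le pJ.
have [_ px] := pJ; rewrite x1 in px.
have dxx : dot x x = 1 by rewrite -dot_norm x1 expr1n.
have dC a b : dot a b = dot b a by have := hermC dot a b; rewrite expr0 mul1r.
have expand a b (t : R) : `|a + t *: b| ^+ 2 =
    `|a| ^+ 2 + 2 * t * dot a b + t ^+ 2 * `|b| ^+ 2.
  rewrite !dot_norm linearDl /= !linearDr /= !linearZl_LR /= !linearZr_LR /=.
  by rewrite (dC b a) /GRing.scale /=; ring.
pose y := z - dot x z *: x.
have xy : dot x y = 0.
  by rewrite /y linearBr /= linearZr_LR /= dxx mulr1 subrr.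
have py0 : p y = 0.
  set a := p y; set k := `|y| ^+ 2 - a ^+ 2.
  have k0 : 0 <= k.
    rewrite subr_ge0 -[a ^+ 2]real_normK ?num_real// lerXn2r ?nnegrE//.
    exact: pabs.
  have k1 : 0 < k + 1 by lra.
  have h (t : R) : 2 * t * a <= t ^+ 2 * k.
    have := pabs (x + t *: y); rewrite linearD linearZ /= px.
    rewrite -(ler_pXn2r (_ : 0 < 2)%N) ?nnegrE// real_normK ?num_real//.
    rewrite expand xy x1 expr1n /k /GRing.scale /= -/a; lra.
  have := h (a / (k + 1)).
  have -> : 2 * (a / (k + 1)) * a = (2 * (k + 1) * a ^+ 2) / (k + 1) ^+ 2.
    by field; rewrite gt_eqF.
  have -> : (a / (k + 1)) ^+ 2 * k = (k * a ^+ 2) / (k + 1) ^+ 2.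
    by field; rewrite gt_eqF.
  rewrite ler_pM2r ?invr_gt0 ?exprn_gt0// => h1.
  have a2 : 0 <= a ^+ 2 by exact: sqr_ge0.
  have ka : 0 <= k * a ^+ 2 by rewrite mulr_ge0.
  by apply/eqP; rewrite -sqrf_eq0 eq_le a2 andbT; lra.
have pz : p z = dot x z.
  by move: py0; rewrite /y linearB linearZ /= px /GRing.scale /= mulr1;
    move/eqP; rewrite subr_eq0 => /eqP.
have -> : x - z = x + (-1) *: z by rewrite scaleN1r.
rewrite expand linearD linearZ /= px pz x1 z1 /GRing.scale /= !expr2; lra.
Qed.

Theorem theorem1 (R : realType)
    (X : completeNormedModType R) (dimX : dim_ge 2 X)
    (H : completeNormedModType R) (dot : {dot H for idfun})
    (dot_norm : forall x : H, `|x| ^+ 2 = dot x x) (dimH : dim_ge 2 H)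
    (eps : R) (eps_ge0 : 0 <= eps) (eps_le2 : eps <= 2) :
  [/\ (phi_minus X eps <= phi_minus H eps)%E,
      phi_minus H eps = (eps ^+ 2 / 2)%:E,
      (eps ^+ 2 / 2)%:E = phi_plus H eps
    & (phi_plus H eps <= phi_plus X eps)%E].
Proof.
have he : 0 <= eps <= 2 by rewrite eps_ge0.
have minus_le (Y : normedModType R) : dim_ge 2 Y ->
    (phi_minus Y eps <= (eps ^+ 2 / 2)%:E)%E.
  move=> dimY.
  have [x [z [p [x1 z1 xz pJ]]]] :=
    sphere_chord Y eps (-1) dimY he (or_intror erefl).
  rewrite mulN1r opprB subr_le0 => pxz.
  apply: (@le_trans _ _ (p (x - z))%:E); last by rewrite lee_fin.
  by apply: ereal_inf_lbound; exists x, z, p; split; rewrite ?xz.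
have plus_ge (Y : normedModType R) : dim_ge 2 Y ->
    ((eps ^+ 2 / 2)%:E <= phi_plus Y eps)%E.
  move=> dimY.
  have [x [z [p [x1 z1 xz pJ]]]] :=
    sphere_chord Y eps 1 dimY he (or_introl erefl).
  rewrite mul1r subr_le0 => pxz.
  apply: (@le_trans _ _ (p (x - z))%:E); first by rewrite lee_fin.
  by apply: ereal_sup_ubound; exists x, z, p; split; rewrite ?xz.
have minusH : phi_minus H eps = (eps ^+ 2 / 2)%:E.
  apply/eqP; rewrite eq_le minus_le//=; apply: le_ereal_inf_tmp.
  move=> _ [x [z [p [x1 z1 xz pJ ->]]]].
  by rewrite (J1_dot dot dot_norm x1 z1 pJ) lee_fin ler_pM2r// lerXn2r ?nnegrE.
have plusH : (eps ^+ 2 / 2)%:E = phi_plus H eps.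
  apply/eqP; rewrite eq_le plus_ge//=; apply: ge_ereal_sup.
  move=> _ [x [z [p [x1 z1 xz pJ ->]]]].
  by rewrite (J1_dot dot dot_norm x1 z1 pJ) lee_fin ler_pM2r// lerXn2r ?nnegrE.
by split; rewrite // ?minusH -?plusH; [exact: minus_le|exact: plus_ge].
Qed.
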